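(* Fix an integer $d\geq 2$. (1) If $n\geq k\geq \lfloor d/2\rfloor+1$, then \[\left\lceil \frac{(\lfloor d/2\rfloor+1)\,n}{k}\right\rceil-1\;\leq\; q(n,d,k).\] (2) Furthermore, if $k\geq 2$ and $n$ is sufficiently large (for the fixed $d$ and $k$), then \[q(n,d,k)\;\leq\;\left\lceil \frac{(\lceil d/2\rceil+1)(n-1)}{k}\right\rceil+(\lceil d/2\rceil+1).\]
   Context: Here $n$ and $k$ are integers and $[n]=\{1,\dots,n\}$. A family $\mathcal{A}$ of subsets of $[n]$ is called $d$-separating if for any two distinct sets $D_1,D_2\subset[n]$, each of size exactly $d$, there is a member $A\in\mathcal{A}$ such that either $A\cap D_1\neq\emptyset$ and $A\cap D_2=\emptyset$, or $A\cap D_1=\emptyset$ and $A\cap D_2\neq\emptyset$. The members of $\mathcal{A}$ are called queries. $q(n,d,k)$ denotes the minimum number of queries, each a subset of $[n]$ of size at most $k$, needed to determine non-adaptively an unknown defective set $Y\subset[n]$ of size exactly $d$ (a query $A$ is answered positively if and only if $A\cap Y\neq\emptyset$, and all queries are fixed in advance). Equivalently, $q(n,d,k)$ is the minimum size of a $d$-separating family of subsets of $[n]$ all of whose members have size at most $k$.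
   Formalization: Part (1) is stated with the extra hypothesis n > d: for n ≤ d there are no two distinct d-subsets, so q(n,d,k) = 0 while the lower bound is at least ⌊d/2⌋ ≥ 1 (e.g. d = n = k = 2 gives 1 ≤ 0), so the claim fails in every excluded case. *)

(* Defs.v *)
From mathcomp Require Import all_boot all_order all_algebra.

Set Implicit Arguments.
Unset Strict Implicit.
Unset Printing Implicit Defensive.

(* The ground set [n] = {1, ..., n} is represented by 'I_n = {0, ..., n-1}. *)

Definition separates n (A D1 D2 : {set 'I_n}) : bool :=
  ((A :&: D1 != set0) && (A :&: D2 == set0))
  || ((A :&: D1 == set0) && (A :&: D2 != set0)).

Definition d_separating n (d : nat) (F : {set {set 'I_n}}) : bool :=
  [forall D1 : {set 'I_n}, forall D2 : {set 'I_n},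
    [&& #|D1| == d, #|D2| == d & D1 != D2] ==>
    [exists A in F, separates A D1 D2]].

Definition query_family n (d k : nat) (F : {set {set 'I_n}}) : bool :=
  d_separating d F && [forall A in F, #|A| <= k].

Definition singletons n : {set {set 'I_n}} := [set [set x] | x : 'I_n].

(* The default value of the arg min is used only if there is no admissible    *)
(* family, which can happen only for k = 0: see singletons_query and qP.      *)
Definition q (n d k : nat) : nat :=
  #|[arg min_(F < singletons n | query_family d k F) #|F|]|.

Lemma singletons_query n d k : 0 < k -> query_family d k (singletons n).
Proof.
move=> k0; apply/andP; split; last first.
  by apply/forall_inP => A /imsetP[x _ ->]; rewrite cards1.
apply/forallP => D1; apply/forallP => D2.
apply/implyP => /and3P[/eqP c1 /eqP c2 neq].
have /subsetPn[x xD1 xD2] : ~~ (D1 \subset D2).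
  by apply: contra neq => s; rewrite eqEcard s c1 c2 leqnn.
apply/exists_inP; exists [set x]; first exact: imset_f.
apply/orP; left; apply/andP; split.
  by apply/set0Pn; exists x; rewrite !inE eqxx.
by rewrite setI_eq0 disjoints1.
Qed.

Lemma qP n d k : 0 < k ->
  (exists2 F : {set {set 'I_n}}, query_family d k F & #|F| = q n d k)
  /\ (forall F : {set {set 'I_n}}, query_family d k F -> q n d k <= #|F|).
Proof.
move=> k0; rewrite /q; case: arg_minnP; first exact: singletons_query.
by move=> F qF minF; split=> //; exists F.
Qed.

(* Main.v *)
(* Lower bound. Two elements x, y without singleton queries lie in at least d *)
(* queries that contain exactly one of them: otherwise d - 1 further elements *)
(* hit all these queries, and adding x or y to them gives two sets that are   *)
(* not separated. So at most one element without a singleton query has degree *)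
(* at most s = floor(d/2), unless d = 2s and such elements have degree s; in  *)
(* that case each of them shares a query with its own private element of      *)
(* degree at least s + 2, or with a singleton query. Double counting the      *)
(* incidences, with weight k on each singleton query, gives the bound.        *)
(*                                                                            *)
(* Upper bound. Let t = ceil(d/2) + 1. The blocks of t partitions of the      *)
(* ground set separate the d-sets as soon as the element-block incidence      *)
(* graph is acyclic on every set of at most 2d elements. Such partitions into *)
(* M blocks of size k exist for all large M: passing to the (Z/p)^edges-cover *)
(* of the incidence graph, in which crossing an edge adds its basis vector,   *)
(* destroys the shortest cycles, so iterating gives an example in which M is  *)
(* a power of p; disjoint unions of examples for p = 2 and p = 3 reach every  *)
(* large M.                                                                   *)
Require Import Defs.
From mathcomp Require Import all_boot all_order all_algebra zify.
Set Implicit Arguments.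
Unset Strict Implicit.
Unset Printing Implicit Defensive.

(** Lower bound: exchanging x for y in a d-set is noticed only by queries containing exactly one of
    them, so d - 1 other points never hit all these queries ([unhit_query]). Hence two points
    without singleton queries have total degree at least d ([weightD_ge]), and more than d when
    queries at them share a third point ([common_point_weight]). Apart from one possible exception,
    points then have weight floor(d/2) + 1 on average, while a query carries total weight at most k
    ([query_count_lower]).

    Upper bound: the queries are the blocks of t = ceil(d/2) + 1 partitions whose incidence graph is
    a forest on any 2d points; unseparated d-sets would force too many incidences on too few blocks
    ([acyclic_separating]). Iterated covers produce such partitions with a power of 2 or of 3 as
    number of blocks ([labelled_cover_acyclic], [arrangement_power]), and disjoint unions reach
    every large number ([arrangement_large]). *)

Lemma subset_card_between (T : finType) (D B : {set T}) m :
  D \subset B -> #|D| <= m <= #|B| ->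
  exists D' : {set T}, [/\ D \subset D', D' \subset B & #|D'| = m].
Proof.
move=> sDB /andP[Dm mB].
set s := take (m - #|D|) (enum (B :\: D)).
have s_sub x : x \in s -> x \in B :\: D by move/mem_take; rewrite mem_enum.
have cs : #|[set x in s]| = m - #|D|.
  rewrite cardsE (card_uniqP _) ?take_uniq ?enum_uniq // size_take -cardE.
  by rewrite cardsDS //; case: ltnP => ?; lia.
exists (D :|: [set x in s]); split; first exact: subsetUl.
  by rewrite subUset sDB; apply/subsetP => x; rewrite inE => /s_sub /setDP[].
rewrite cardsU cs (_ : D :&: _ = set0) ?cards0; first lia.
apply/setP => x; rewrite !inE; apply/negP => /andP[xD /s_sub].
by rewrite inE xD.
Qed.

(** * Lower bound: degrees of points and double counting *)

Section Lower.
Variables (n d k : nat) (F : {set {set 'I_n}}).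
Hypotheses (sepF : d_separating d F) (dn : d < n).

Lemma unhit_query x y (D : {set 'I_n}) :
    x != y -> x \notin D -> y \notin D -> #|D| < d ->
  exists2 A, A \in F & ((x \in A) (+) (y \in A)) && (A :&: D == set0).
Proof.
move=> xy xD yD cD.
(* There is room to pad D to d - 1 points avoiding x and y, since n - 2 >= d - 1. *)
have [||D' [sDD' sD'xy cD']] := @subset_card_between _ D (~: [set x; y]) d.-1.
- by apply/subsetP => z zD; rewrite !inE negb_or; apply/andP; split;
    apply: contraTneq zD => ->.
- have := cardsC [set x; y]; rewrite cards2 xy card_ord; lia.
have [xD' yD'] : x \notin D' /\ y \notin D'.
  by split; apply/negP => /(subsetP sD'xy); rewrite !inE eqxx ?orbT.
have /forallP /(_ (x |: D')) /forallP /(_ (y |: D')) /implyP := sepF.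
have neq : x |: D' != y |: D'.
  by apply/eqP => /setP /(_ x); rewrite !inE eqxx (negPf xD') (negPf xy).
rewrite !cardsU1 xD' yD' cD' neq andbT => /(_ _)/exists_inP[|A AF sepA].
  by apply/andP; split; apply/eqP; lia.
exists A => //; move: sepA; rewrite /separates !setIUr.
have I1 z : A :&: [set z] = if z \in A then [set z] else set0.
  by apply/setP => w; rewrite !inE; case: ifP => zA; rewrite inE;
     case: eqP => [->|]; rewrite ?zA ?andbF.
have AD' : A :&: D' == set0 -> A :&: D == set0.
  by rewrite -!subset0 => /(subset_trans _); apply; exact: setIS.
rewrite !I1 !setU_eq0; case: (x \in A); case: (y \in A);
  rewrite -?cards_eq0 ?cards1 ?cards0 ?(cards_eq0 (A :&: D')) ?(cards_eq0 (A :&: D)) /=;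
  by case: eqP AD' => //= _ /(_ isT) ->.
Qed.

Definition diff_queries x y := [set A in F | (x \in A) (+) (y \in A)].

(** Queries in [S0] are hit one at a time, each by a point of its own outside x and y, and [D0] hits
    the others; fewer than d points in all would contradict [unhit_query]. The count improves when a
    point of [D0] hits several queries at once. *)
Lemma diff_queries_card x y (S0 : {set {set 'I_n}}) (D0 : {set 'I_n}) :
    x != y -> (forall A, A \in diff_queries x y -> #|A| != 1) ->
    x \notin D0 -> y \notin D0 ->
    (forall A, A \in diff_queries x y -> A \notin S0 -> A :&: D0 != set0) ->
  d <= #|S0 :&: diff_queries x y| + #|D0|.
Proof.
move=> xy big xD0 yD0 hit; rewrite leqNgt; apply/negP => small.
have ex A : A \in diff_queries x y -> exists z, z \in A :\: [set x; y].
  move=> AS; have := big A AS; move: AS; rewrite inE => /andP[_ xor].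
  move=> /negP cA; apply/set0Pn; apply/negP; rewrite setD_eq0 => /subsetP sA; apply: cA.
  case: (boolP (x \in A)) xor => xA /= yA; apply/cards1P.
    exists x; apply/setP => z; rewrite inE; apply/idP/eqP => [zA|->//].
    by have := sA _ zA; rewrite !inE => /orP[/eqP//|/eqP zy]; rewrite -zy zA in yA.
  exists y; apply/setP => z; rewrite inE; apply/idP/eqP => [zA|->//].
  by have := sA _ zA; rewrite !inE => /orP[/eqP zy|/eqP//]; rewrite -zy zA in xA.
pose c A := odflt x [pick z in A :\: [set x; y]].
have cP A : A \in diff_queries x y -> c A \in A :\: [set x; y].
  by move=> /ex[z zA]; rewrite /c; case: pickP => //= /(_ z); rewrite zA.
pose D := D0 :|: c @: (S0 :&: diff_queries x y).
have cD : #|D| < d.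
  apply: leq_ltn_trans small; rewrite cardsU addnC.
  by apply: leq_trans (leq_subr _ _) _; rewrite leq_add2r leq_imset_card.
have notD z : z \in [set x; y] -> z \notin D0 -> z \notin D.
  move=> zxy zD0; rewrite inE (negPf zD0) /=; apply/imsetP => -[A /setIP[_ /cP]].
  by move=> cA ez; move: cA; rewrite -ez inE zxy.
have [||A AF /andP[xor /eqP AD]] := unhit_query xy _ _ cD.
- by apply: notD; rewrite // !inE eqxx.
- by apply: notD; rewrite // !inE eqxx orbT.
have AS : A \in diff_queries x y by rewrite inE AF.
have [AS0|AS0] := boolP (A \in S0).
  have : c A \in A :&: D.
    rewrite inE; have /setDP[-> _] := cP _ AS; rewrite inE imset_f ?orbT //.
    by rewrite inE AS0.
  by rewrite AD inE.
have /set0Pn[z /setIP[zA zD]] := hit A AS AS0.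
by have : z \in A :&: D; [rewrite !inE zA zD | rewrite AD inE].
Qed.

(** A singleton query counts k, so a point that has one is never light, yet each query still
    contributes at most k in total. *)
Definition weight x := \sum_(A in F | x \in A) (if #|A| == 1 then k else 1).

Lemma sum_weight : (forall A, A \in F -> #|A| <= k) -> 
  \sum_x weight x <= k * #|F|.
Proof.
move=> sizeF; rewrite /weight.
rewrite (exchange_big_dep (fun A => A \in F)) //=; last by move=> ? ? _ /andP[].
rewrite mulnC -sum_nat_const; apply: leq_sum => A AF.
rewrite (eq_bigl (fun x => x \in A)); last by move=> x; rewrite AF.
rewrite sum_nat_const; case: eqP => [->|_]; first by rewrite mul1n.
by rewrite muln1 sizeF.
Qed.

Lemma weight_singleton x : [set x] \in F -> k <= weight x.
Proof.
by move=> xF; rewrite /weight (bigD1 [set x]) ?xF ?set11 //= cards1 leq_addr.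
Qed.

Lemma weight_singletonS x A : [set x] \in F -> A \in F -> x \in A ->
  #|A| != 1 -> k < weight x.
Proof.
move=> xF AF xA cA; rewrite /weight (bigD1 [set x]) ?xF ?set11 //= cards1 /=.
rewrite (bigD1 A) /=; last first.
  by rewrite AF xA; apply: contraNneq cA => ->; rewrite cards1.
by rewrite (negPf cA); lia.
Qed.

Definition queries x := [set A in F | x \in A].

Lemma light_nosingleton x A : [set x] \notin F -> A \in queries x -> #|A| != 1.
Proof.
move=> xF; rewrite inE => /andP[AF xA]; apply: contra xF => /cards1P[y eA].
by move: xA; rewrite eA inE => /eqP ->; rewrite -eA.
Qed.

Lemma weight_card x : [set x] \notin F -> weight x = #|queries x|.
Proof.
move=> xF; rewrite /weight -sum1_card; apply: eq_big => A; first by rewrite inE.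
move=> AF; rewrite ifN //; apply: light_nosingleton xF _; by rewrite inE.
Qed.

Lemma diff_queriesE x y : #|diff_queries x y| + #|queries x :&: queries y|.*2
  = #|queries x| + #|queries y|.
Proof.
rewrite -(cardsID (queries y) (queries x)) -(cardsID (queries x) (queries y)).
rewrite (setIC (queries y)) -(cardsID (queries x) (diff_queries x y)).
have -> : diff_queries x y :&: queries x = queries x :\: queries y.
  by apply/setP => A; rewrite !inE; case: (A \in F); case: (x \in A); case: (y \in A).
have -> : diff_queries x y :\: queries x = queries y :\: queries x.
  by apply/setP => A; rewrite !inE; case: (A \in F); case: (x \in A); case: (y \in A).
lia.
Qed.

Lemma diff_queries_nosingleton x y : [set x] \notin F -> [set y] \notin F ->
  forall A, A \in diff_queries x y -> #|A| != 1.
Proof.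
move=> xF yF A; rewrite inE => /andP[AF]; case: (boolP (x \in A)) => xA /= yA.
  by apply: light_nosingleton xF _; rewrite inE AF.
by apply: light_nosingleton yF _; rewrite inE AF.
Qed.

Lemma weightD_ge x y : x != y -> [set x] \notin F -> [set y] \notin F ->
  d + #|queries x :&: queries y|.*2 <= weight x + weight y.
Proof.
move=> xy xF yF; rewrite !weight_card // -diff_queriesE leq_add2r.
have := @diff_queries_card x y setT set0 xy.
rewrite setTI cards0 addn0 !inE; apply=> //; first exact: diff_queries_nosingleton.
by move=> A _; rewrite inE.
Qed.

Lemma common_point_weight x y z A B : x != y -> z != x -> z != y ->
    [set x] \notin F -> [set y] \notin F ->
    A \in queries x -> B \in queries y -> z \in A -> z \in B ->
  d < weight x + weight y.
Proof.
move=> xy zx zy xF yF Ax By zA zB.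
have [/eqP I0|/set0Pn[C Cxy]] := boolP (queries x :&: queries y == set0); last first.
  have := weightD_ge xy xF yF; have : 0 < #|queries x :&: queries y|.
    by apply/card_gt0P; exists C.
  lia.
have yA : y \notin A.
  apply/negP => yA; have : A \in queries x :&: queries y.
    by move: Ax; rewrite !inE yA => /andP[-> ->].
  by rewrite I0 inE.
have xB : x \notin B.
  apply/negP => xB; have : B \in queries x :&: queries y.
    by move: By; rewrite !inE xB => /andP[-> ->].
  by rewrite I0 inE.
have AB : A != B by apply: contraTneq Ax => ->; rewrite inE (negPf xB) andbF.
have AS : A \in diff_queries x y.
  by move: Ax; rewrite !inE (negPf yA) => /andP[-> ->].
have BS : B \in diff_queries x y.
  by move: By; rewrite !inE (negPf xB) => /andP[-> ->].
rewrite !weight_card // -diff_queriesE I0 cards0 addn0.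
(* The single point z hits both A and B, which saves one point and makes the bound strict. *)
have := @diff_queries_card x y (~: [set A; B]) [set z] xy.
rewrite cards1 !inE ![_ == z]eq_sym zx zy.
move=> /(_ (diff_queries_nosingleton xF yF) isT isT) le.
have {le} : d <= #|~: [set A; B] :&: diff_queries x y| + 1.
  apply: le => C _; rewrite !inE negbK => /orP[]/eqP ->; apply/set0Pn; exists z;
  by rewrite !inE eqxx ?zA ?zB.
have := cardsID [set A; B] (diff_queries x y); rewrite setDE setIC (setIC _ (~: _)).
have /setIidPl -> : [set A; B] \subset diff_queries x y by rewrite subUset !sub1set AS.
by rewrite cards2 AB => <-; rewrite addn1 !addSn add0n.
Qed.

Lemma query_count_lower :
  1 < d -> d./2 < k -> (forall A, A \in F -> #|A| <= k) ->
  d./2.+1 * n <= k * #|F|.+1.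
Proof.
move=> d2 dk sizeF; set s := d./2 in dk *.
apply: (@leq_trans (\sum_x weight x + k)); last first.
  by rewrite mulnS addnC leq_add2l sum_weight.
pose X := [set x | weight x <= s].
have Xns x : x \in X -> [set x] \notin F.
  rewrite inE => wx; apply/negP => /weight_singleton; lia.
have sumn : s.+1 * n = \sum_(x : 'I_n) s.+1.
  by rewrite sum_nat_const card_ord mulnC.
have sumX (Y : {set 'I_n}) : \sum_x (x \in Y) = #|Y|.
  by rewrite -sum1_card [RHS]big_mkcond; apply: eq_bigr => x _; case: (x \in Y).
(* A single light point costs at most s + 1 <= k, absorbed by the extra k. *)
have [X1|X2] := leqP #|X| 1.
  suff : s.+1 * n <= \sum_x weight x + \sum_x s.+1 * (x \in X).
    rewrite -big_distrr /= sumX; nia.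
  rewrite sumn -big_split /=; apply: leq_sum => x _.
  by rewrite inE; case: (leqP (weight x) s); lia.
have other x : exists2 y, y \in X & x != y.
  have /card_gt0P[y] : 0 < #|X :\ x| by have := cardsD1 x X; lia.
  by rewrite !inE => /andP[yx yX]; exists y; rewrite 1?eq_sym ?inE.
(* Two light points have total weight at most 2s <= d, so [weightD_ge] is tight. *)
have wX x : x \in X -> d = s.*2 /\ weight x = s.
  move=> xX; have [y yX xy] := other x.
  have := weightD_ge xy (Xns x xX) (Xns y yX).
  move: xX yX; rewrite !inE /s; lia.
have [x0 x0X] : exists x0, x0 \in X by apply/card_gt0P; lia.
have ds := (wX _ x0X).1.
have partner x : exists z, x \in X ->
    [/\ z != x, s.+2 <= weight z & exists2 A, A \in queries x & z \in A].
  have [xX|_] := boolP (x \in X); last by exists x.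
  have : 0 < #|queries x| by rewrite -weight_card ?Xns // (wX x xX).2 /s; lia.
  move=> /card_gt0P[A Ax]; have cA := light_nosingleton (Xns x xX) Ax.
  have [AF xA] : A \in F /\ x \in A by move: Ax; rewrite inE => /andP.
  have /card_gt0P[z] : 0 < #|A :\ x| by have := cardsD1 x A; rewrite xA; lia.
  rewrite !inE => /andP[zx zA]; exists z => _; split => //; last by exists A.
  have [zF|zF] := boolP ([set z] \in F).
    by have := weight_singletonS zF AF zA cA; lia.
  have xz : x != z by rewrite eq_sym.
  have := weightD_ge xz (Xns x xX) zF; rewrite (wX x xX).2 ds.
  have : 0 < #|queries x :&: queries z|.
    by apply/card_gt0P; exists A; rewrite !inE AF xA.
  lia.
have [f fP] := fin_all_exists partner.
have finj : {in X &, injective f}.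
  move=> x y xX yX fxy; apply/eqP; apply/negPn/negP => xy.
  have [zx _ [A Ax zA]] := fP x xX; have [zy _ [B By zB]] := fP y yX.
  rewrite -fxy in zy zB.
  have := common_point_weight xy zx zy (Xns x xX) (Xns y yX) Ax By zA zB.
  rewrite (wX x xX).2 (wX y yX).2; lia.
(* Each light point falls short of s + 1 by exactly 1, and its private partner exceeds s + 1 by at
   least 1. *)
suff : s.+1 * n + \sum_x (x \in f @: X) <= \sum_x weight x + \sum_x (x \in X).
  rewrite !sumX card_in_imset //; lia.
rewrite sumn -!big_split /=; apply: leq_sum => x _.
have [/imsetP[y yX ex]|_] := boolP (x \in f @: X).
  by have [_ + _] := fP y yX; rewrite -ex; lia.
case: (boolP (x \in X)) => xX; first by rewrite (wX x xX).2; lia.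
by move: xX; rewrite inE; lia.
Qed.

End Lower.

(** * Forests described by counting incidences *)

Section Incidence.
Variables (A B : finType) (R : A -> B -> bool).

Definition incidences (E : {set A}) (V : {set B}) :=
  \sum_(e in E) #|[set v in V | R e v]|.

Lemma incidencesC E V : incidences E V = \sum_(v in V) #|[set e in E | R e v]|.
Proof.
rewrite /incidences.
under eq_bigr => e _.
  rewrite -sum1_card (eq_bigl (fun v => (v \in V) && R e v)); last first.
    by move=> v; rewrite inE.
  over.
rewrite (exchange_big_dep (mem V)) /=; last by move=> e v _ /andP[].
apply: eq_bigr => v vV; rewrite -sum1_card; apply: eq_bigl => e.
by rewrite inE vV.
Qed.

(** A nonempty forest has fewer edges than vertices and a cycle has equally many, so quantifying
    over all E and V says that no cycle uses at most s elements of A, without speaking of paths. *)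
Definition acyclic_upto s := forall E V,
  E != set0 -> #|E| <= s -> incidences E V < #|E| + #|V|.

Definition has_leaf (E : {set A}) (V : {set B}) :=
  [exists e in E, #|[set v in V | R e v]| <= 1]
  || [exists v in V, #|[set e in E | R e v]| <= 1].

Lemma acyclic_has_leaf s E V :
  acyclic_upto s -> E != set0 -> #|E| <= s -> has_leaf E V.
Proof.
move=> acyc E0 Es; apply: contraT; rewrite negb_or => /andP[noE noV].
have := acyc E V E0 Es.
have leE : #|E| * 2 <= incidences E V.
  rewrite -sum_nat_const; apply: leq_sum => e eE; rewrite ltnNge.
  by apply: contra noE => le1; apply/exists_inP; exists e.
have leV : #|V| * 2 <= incidences E V.
  rewrite -sum_nat_const incidencesC; apply: leq_sum => v vV; rewrite ltnNge.
  by apply: contra noV => le1; apply/exists_inP; exists v.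
by move: (incidences E V) #|E| #|V| leE leV => i e v; clear; lia.
Qed.

(** Deleting a leaf removes one vertex and at most one incidence. *)
Lemma has_leaf_acyclic s :
  (forall E V, E != set0 -> #|E| <= s -> has_leaf E V) -> acyclic_upto s.
Proof.
move=> leaf E V; have [m] := ubnP (#|E| + #|V|).
elim: m E V => // m IHm E V ltm E0 Es.
case/orP: (leaf E V E0 Es) => /exists_inP[].
  move=> e eE deg_e; have cE := cardsD1 e E; rewrite eE add1n in cE.
  rewrite /incidences (big_setD1 e) //=.
  have [E10|E10] := eqVneq (E :\ e) set0.
    rewrite E10 big_set0 cE E10 cards0 addn0 add1n ltnS.
    by apply/subset_leq_card/subsetP => v; rewrite inE => /andP[].
  rewrite cE addSn in ltm *; rewrite ltnS.
  apply: (@leq_trans (1 + incidences (E :\ e) V)); first by rewrite leq_add2r.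
  by rewrite add1n; apply: IHm => //; apply: leq_trans Es; rewrite cE.
move=> v vV deg_v; have cV := cardsD1 v V; rewrite vV add1n in cV.
rewrite incidencesC (big_setD1 v) //= -incidencesC cV.
rewrite cV addnS in ltm *; rewrite ltnS.
apply: (@leq_trans (1 + incidences E (V :\ v))); first by rewrite leq_add2r.
by rewrite add1n; apply: IHm.
Qed.

End Incidence.

(** * Coverings that destroy the shortest cycles *)

Section Covering.
Variables (A B A' B' : finType) (R : A -> B -> bool) (R' : A' -> B' -> bool).
Variables (piA : A' -> A) (piB : B' -> B) (s : nat).
Hypothesis homR : forall e v, R' e v -> R (piA e) (piB v).
Hypothesis injB : forall e v v', R' e v -> R' e v' -> piB v = piB v' -> v = v'.
Hypothesis injA : forall e e' v, R' e v -> R' e' v -> piA e = piA e' -> e = e'.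
Hypothesis acyc : acyclic_upto R s.

(** The projection is injective on neighbourhoods, so a vertex lying over a leaf is a leaf. Only the
    image of E has to be small. *)
Lemma cover_has_leaf E V : E != set0 -> #|piA @: E| <= s -> has_leaf R' E V.
Proof.
move=> /set0Pn[e0 e0E] Es; have piE0 : piA @: E != set0.
  by apply/set0Pn; exists (piA e0); exact: imset_f.
case/orP: (acyclic_has_leaf (piB @: V) acyc piE0 Es) => /exists_inP[].
  move=> _ /imsetP[e eE ->] deg; apply/orP; left; apply/exists_inP; exists e => //.
  apply: leq_trans deg; rewrite -(card_in_imset (f := piB)).
    apply/subset_leq_card/subsetP => _ /imsetP[v /setIdP[vV ev] ->].
    by rewrite inE imset_f // homR.
  by move=> v v' /setIdP[_ ev] /setIdP[_]; exact: injB ev.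
move=> _ /imsetP[v vV ->] deg; apply/orP; right; apply/exists_inP; exists v => //.
apply: leq_trans deg; rewrite -(card_in_imset (f := piA)).
  apply/subset_leq_card/subsetP => _ /imsetP[e /setIdP[eE ev] ->].
  by rewrite inE imset_f // homR.
by move=> e e' /setIdP[_ ev] /setIdP[_]; exact: injA ev.
Qed.

Lemma cover_acyclic : acyclic_upto R' s.
Proof.
apply: has_leaf_acyclic => E V E0 Es; apply: cover_has_leaf => //.
exact: leq_trans (leq_imset_card _ _) Es.
Qed.

(* The labels detect crossings of a single edge of the base. A subgraph with  *)
(* s + 1 elements that does not embed into the base projects to a forest;     *)
(* otherwise the labels of an edge (e0, v0) of it cut the subgraph along that *)
(* edge alone, and the part containing e0 is a smaller subgraph with at most  *)
(* one leaf.                                                                  *)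
Lemma labelled_cover_acyclic (L : eqType)
    (labA : A * B -> A' -> L) (labB : A * B -> B' -> L) :
    (forall p e v, R p.1 p.2 -> R' e v ->
       (labA p e == labB p v) = (p != (piA e, piB v))) ->
  acyclic_upto R' s.+1.
Proof.
move=> lab; apply: has_leaf_acyclic => E V E0 Es.
have [|ltE] := leqP #|piA @: E| s; first exact: cover_has_leaf.
have piE : {in E &, injective piA}.
  apply/imset_injP/eqP; apply/eqP; rewrite eqn_leq leq_imset_card.
  exact: leq_trans Es ltE.
apply: contraT; rewrite negb_or => /andP[noE noV].
have degE e : e \in E -> 1 < #|[set v in V | R' e v]|.
  by move=> eE; rewrite ltnNge; apply: contra noE => le1; apply/exists_inP; exists e.
have degV v : v \in V -> 1 < #|[set e in E | R' e v]|.
  by move=> vV; rewrite ltnNge; apply: contra noV => le1; apply/exists_inP; exists v.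
have [e0 e0E] := set0Pn _ E0.
have /card_gt0P[v0 /setIdP[v0V R0]] := ltnW (degE e0 e0E).
pose p := (piA e0, piB v0); have Rp : R p.1 p.2 by exact: homR.
pose E1 := [set e in E | labA p e == labA p e0].
pose V1 := [set v in V | labB p v == labA p e0].
have e0E1 : e0 \in E1 by rewrite inE e0E eqxx.
have v0V1 : v0 \notin V1 by rewrite inE v0V eq_sym lab // eqxx.
(* A second neighbour e1 of v0 has the label of v0, hence lies across the cut; so E1 is smaller than
   E. *)
have [e1 e1E e1E1] : exists2 e, e \in E & e \notin E1.
  have := cardsD1 e0 [set e in E | R' e v0]; rewrite inE e0E R0 add1n => cN.
  have := degV v0 v0V; rewrite cN ltnS => /card_gt0P[e1].
  rewrite !inE => /and3P[e10 e1E R1]; exists e1 => //; rewrite inE e1E /=.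
  have /eqP -> : labA p e1 == labB p v0.
    by rewrite lab //; apply: contra e10 => /eqP[/piE -> //].
  by rewrite eq_sym lab // eqxx.
have E1s : #|E1| <= s.
  rewrite -ltnS; apply: leq_trans Es; apply/proper_card/properP; split.
    by apply/subsetP => e /setIdP[].
  by exists e1.
have E10 : E1 != set0 by apply/set0Pn; exists e0.
have := cover_acyclic V1 E10 E1s.
(* Inside the cut-off part only e0 loses a neighbour, namely v0, so all other degrees remain at
   least 2 and there are too many incidences for a forest. *)
have leE : #|E1| * 2 <= (incidences R' E1 V1).+1.
  rewrite /incidences (cardsD1 e0) e0E1 mulnDl (big_setD1 e0) //= -addSn.
  apply: leq_add.
    apply: (leq_trans (degE e0 e0E)); rewrite (cardsD1 v0) -add1n.
    apply: leq_add; first exact: leq_b1.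
    apply/subset_leq_card/subsetP => v; rewrite !inE => /and3P[vv0 vV Rv].
    rewrite vV Rv eq_sym lab //= andbT.
    by apply: contra vv0 => /eqP[/(injB R0 Rv) ->].
  rewrite -sum_nat_const; apply: leq_sum => e; rewrite !inE => /and3P[ee0 eE le].
  apply: (leq_trans (degE e eE)).
  apply/subset_leq_card/subsetP => v; rewrite !inE => /andP[vV Rv].
  rewrite vV Rv andbT /= -(eqP le) eq_sym lab //.
  by apply: contra ee0 => /eqP[/piE ->].
have leV : #|V1| * 2 <= incidences R' E1 V1.
  rewrite -sum_nat_const incidencesC; apply: leq_sum => v vV1.
  have /setIdP[vV lv] := vV1; apply: (leq_trans (degV v vV)).
  apply/subset_leq_card/subsetP => e; rewrite !inE => /andP[eE Re].
  rewrite eE Re andbT /= -(eqP lv) lab //.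
  apply: contraNneq v0V1 => -[/piE e0e /esym vv0].
  have e_e0 : e = e0 by rewrite e0e.
  by rewrite -(@injB e0 v v0 _ _ vv0) // -e_e0.
by move: (incidences _ _ _) #|E1| #|V1| leE leV => i e v; clear; lia.
Qed.

End Covering.

(** The image is closed under adjacency, so a leaf found inside it is a leaf of the whole graph. *)
Lemma embed_has_leaf (A B A' B' : finType) (R : A -> B -> bool)
    (R' : A' -> B' -> bool) (gA : A -> A') (gB : B -> B') s e0 (E : {set A'}) (V : {set B'}) :
    injective gA ->
    (forall e v', R' (gA e) v' -> exists2 v, v' = gB v & R e v) ->
    (forall e' v, R' e' (gB v) -> exists2 e, e' = gA e & R e v) ->
    acyclic_upto R s -> gA e0 \in E -> #|E| <= s ->
  has_leaf R' E V.
Proof.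
move=> injA nbrA nbrB acyc e0E Es.
have E10 : gA @^-1: E != set0 by apply/set0Pn; exists e0; rewrite inE.
have E1s : #|gA @^-1: E| <= s.
  apply: leq_trans Es; rewrite -(card_imset _ injA).
  by apply/subset_leq_card/subsetP => _ /imsetP[e + ->]; rewrite inE.
case/orP: (acyclic_has_leaf (gB @^-1: V) acyc E10 E1s) => /exists_inP[].
  move=> e; rewrite inE => eE deg; apply/orP; left; apply/exists_inP.
  exists (gA e) => //; apply: leq_trans deg.
  apply: leq_trans (leq_imset_card gB _); apply/subset_leq_card/subsetP => v'.
  by rewrite inE => /andP[v'V /nbrA[v ev Rv]]; apply/imsetP; exists v; rewrite // !inE -ev v'V.
move=> v; rewrite inE => vV deg; apply/orP; right; apply/exists_inP.
exists (gB v) => //; apply: leq_trans deg.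
apply: leq_trans (leq_imset_card gA _); apply/subset_leq_card/subsetP => e'.
by rewrite inE => /andP[e'E /nbrB[e ee Re]]; apply/imsetP; exists e; rewrite // !inE -ee e'E.
Qed.

(** * Partitions with locally acyclic incidence graph *)

Section Arrangement.
Variables t k : nat.

(* The elements are the pairs (a, j), and the i-th partition puts (a, j) in   *)
(* the block labelled c i j a, so every block has exactly k elements.         *)
Definition in_block (T : finType) (c : 'I_t -> 'I_k -> T -> T)
    (x : T * 'I_k) (v : 'I_t * T) : bool := c v.1 x.2 x.1 == v.2.

Definition arrangement s M := exists (T : finType) (c : 'I_t -> 'I_k -> T -> T),
  [/\ #|T| = M, forall i j, injective (c i j) & acyclic_upto (in_block c) s].

Lemma arrangement0 s : arrangement s 0.
Proof.
exists void, (fun _ _ x => x); split; [exact: card_void | by move=> ? ? [] | ].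
by move=> E V /set0Pn[[[]]].
Qed.

Lemma arrangementD s M1 M2 :
  arrangement s M1 -> arrangement s M2 -> arrangement s (M1 + M2).
Proof.
move=> [T1 [c1 [card1 inj1 acyc1]]] [T2 [c2 [card2 inj2 acyc2]]].
pose c i j (x : T1 + T2) :=
  match x with inl a => inl (c1 i j a) | inr a => inr (c2 i j a) end.
exists (T1 + T2)%type, c; split.
- by rewrite card_sum card1 card2.
- by move=> i j [a|a] [b|b] //= [eqc];
    rewrite ?(inj1 _ _ _ _ eqc) ?(inj2 _ _ _ _ eqc).
apply: has_leaf_acyclic => E V /set0Pn[[[a|a] j] aE] Es.
- apply: (@embed_has_leaf _ _ _ _ (in_block c1) _ (fun x => (inl x.1, x.2))
    (fun v => (v.1, inl v.2)) s (a, j)) => //.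
  + by move=> [? ?] [? ?] /= [-> ->].
  + move=> [b l] [i [d|d]] /eqP //= [<-]; exists (i, c1 i l b) => //.
    exact: eqxx.
  + move=> [[b|b] l] [i d] /eqP //= [eqd]; exists (b, l) => //; exact/eqP.
- apply: (@embed_has_leaf _ _ _ _ (in_block c2) _ (fun x => (inr x.1, x.2))
    (fun v => (v.1, inr v.2)) s (a, j)) => //.
  + by move=> [? ?] [? ?] /= [-> ->].
  + move=> [b l] [i [d|d]] /eqP //= [<-]; exists (i, c2 i l b) => //.
    exact: eqxx.
  + move=> [[b|b] l] [i d] /eqP //= [eqd]; exists (b, l) => //; exact/eqP.
Qed.

Lemma arrangementM s M u : arrangement s M -> arrangement s (u * M).
Proof.
move=> arM; elim: u => [|u IHu]; first exact: arrangement0.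
by rewrite mulSn; exact: arrangementD.
Qed.

Lemma arrangement_power s p : exists a, arrangement s (p.+2 ^ a).
Proof.
elim: s => [|s [a [T [c [cardT injc acyc]]]]].
  exists 0, unit, (fun _ _ x => x); split; [exact: card_unit | by move=> ? ? ? | ].
  by move=> E V E0; rewrite leqn0 cards_eq0 (negPf E0).
(* One coordinate per base edge, in the integers mod p + 2, where 1 is nonzero: crossing an edge
   changes its own coordinate and no other. *)
pose edge : finType := ('I_t * 'I_k * T)%type.
pose c' i j (x : T * {ffun edge -> 'I_p.+2}) :=
  (c i j x.1, [ffun e => x.2 e + (e == (i, j, x.1))%:R]%R).
exists (a + #|edge|), (T * {ffun edge -> 'I_p.+2})%type, c'; split.
- by rewrite card_prod cardT card_ffun card_ord expnD.
- move=> i j [x f] [y g] /= [/injc <- /ffunP fg]; congr (_, _).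
  by apply/ffunP => e; have := fg e; rewrite !ffunE => /GRing.addIr.
pose T' : finType := (T * {ffun edge -> 'I_p.+2})%type.
pose piA (x : T' * 'I_k) := (x.1.1, x.2).
pose piB (v : 'I_t * T') := (v.1, v.2.1).
pose labA (b : (T * 'I_k) * ('I_t * T)) (x : T' * 'I_k) :=
  x.1.2 (b.2.1, b.1.2, b.1.1).
pose labB (b : (T * 'I_k) * ('I_t * T)) (v : 'I_t * T') :=
  v.2.2 (b.2.1, b.1.2, b.1.1).
apply: (@labelled_cover_acyclic _ _ _ _ _ _ piA piB s _ _ _ acyc _ labA labB).
- by move=> [[x f] j] [i [y g]] /eqP[<- _]; exact: eqxx.
- by move=> [[x f] j] [i [y g]] [i' [y' g']] /eqP[<- <-] /eqP[<- <-] [->].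
- move=> [[x f] j] [[x' f'] j'] [i [y g]] /eqP[<- <-] /eqP[_ fg] [ex ej].
  subst x' j'; congr (_, _, _); apply/ffunP => e.
  by move/ffunP: fg => /(_ e); rewrite !ffunE => /GRing.addIr ->.
move=> [[x l] [i y]] [[x' f] l'] [i' [y' g]] /= /eqP /= <- /eqP[<- <-].
rewrite /labA /labB /piA /piB /= ffunE -[X in X == _]GRing.addr0 (inj_eq (@GRing.addrI _ _)) !xpair_eqE.
by case: (eqVneq x x') => [<-|_]; case: (eqVneq l l') => [<-|_];
  case: (eqVneq i i') => [<-|_]; rewrite /= ?eqxx ?andbF.
Qed.

Lemma arrangement_large s : exists M0, forall M, M0 <= M -> arrangement s M.
Proof.
have [a ar2] := arrangement_power s 0; have [b ar3] := arrangement_power s 1.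
set m2 := 2 ^ a in ar2; set m3 := 3 ^ b in ar3.
have cop : coprime m2 m3 by rewrite coprimeXl // coprimeXr.
have m2_gt0 : 0 < m2 by rewrite expn_gt0.
have m3_gt0 : 0 < m3 by rewrite expn_gt0.
exists (m2 * m3) => M leM.
(* By the Chinese remainder theorem M splits as r + (M - r), multiples of [m2] and [m3]; M >=
   [m2 * m3] keeps M - r nonnegative. *)
pose r := chinese m2 m3 0 M %% (m2 * m3).
have rM : r <= M.
  by apply: leq_trans leM; apply/ltnW/ltn_pmod; rewrite muln_gt0 m2_gt0.
have r2 : m2 %| r.
  by rewrite /dvdn /r modn_dvdm ?dvdn_mulr // chinese_modl // mod0n.
have r3 : m3 %| M - r.
  rewrite -eqn_mod_dvd // eq_sym /r modn_dvdm ?dvdn_mull //.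
  by rewrite chinese_modr.
rewrite -(subnKC rM) -(divnK r3) -{1}(divnK r2).
by apply: arrangementD; exact: arrangementM.
Qed.

End Arrangement.

(** * From arrangements to query families *)

(* Let P = |D1 \ D2|. If D1 and D2 were not separated, every query meeting    *)
(* their symmetric difference would have degree at least 2 in D1 U D2, so     *)
(* there are fewer than d + P of them; but a forest with 2P edges of size t   *)
(* spans at least 2P(t - 1) + 1 vertices.                                     *)
Lemma acyclic_separating n d t (B : finType) (R : 'I_n -> B -> bool) :
    0 < d -> d <= t.-1.*2 -> (forall x, #|[set v | R x v]| = t) ->
    acyclic_upto R d.*2 ->
  d_separating d [set [set x | R x v] | v : B].
Proof.
move=> d0 dt reg acyc; apply/forallP => D1; apply/forallP => D2.
apply/implyP => /and3P[/eqP c1 /eqP c2 neq]; apply: contraT => nosep.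
have meet v : [exists x in D1, R x v] = [exists x in D2, R x v].
  have E D : ([set x | R x v] :&: D != set0) = [exists x in D, R x v].
    apply/set0Pn/exists_inP => [[x]|[x xD xv]].
      by rewrite !inE => /andP[xv xD]; exists x.
    by exists x; rewrite !inE xv.
  apply: contraNeq nosep => neqv; apply/exists_inP.
  exists [set x | R x v]; first exact: imset_f.
  move: neqv; rewrite /separates -[_ :&: D1 == _]negbK -[_ :&: D2 == _]negbK !E.
  by move: [exists x in D1, R x v] [exists x in D2, R x v] => [] [].
have cI := cardsID D2 D1; have cI' := cardsID D1 D2; rewrite setIC in cI'.
set p := #|D1 :\: D2| in cI.
have p0 : 0 < p.
  rewrite card_gt0 setD_eq0; apply: contra neq => s.
  by rewrite eqEcard s c1 c2 leqnn.
have pd : p <= d by rewrite -c1 -cI leq_addl.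
have cp : #|D2 :\: D1| = p by move: cI cI'; rewrite c1 c2; clear; lia.
pose X := (D1 :\: D2) :|: (D2 :\: D1).
have cX : #|X| = p.*2.
  rewrite cardsU cp -addnn (_ : _ :&: _ = set0) ?cards0 ?subn0 //.
  by apply/setP => x; rewrite !inE; case: (x \in D1); rewrite ?andbF.
have cU : #|D1 :|: D2| = d + p.
  by move: cI; rewrite cardsU c1 c2 setIC -/p => <-; clear; lia.
pose V := [set v | [exists x in X, R x v]].
have X0 : X != set0 by rewrite -card_gt0 cX double_gt0.
have degX x : x \in X -> #|[set v in V | R x v]| = t.
  move=> xX; rewrite -(reg x); apply: eq_card => v; rewrite !inE andbC.
  by case: (boolP (R x v)) => //= xv; apply/exists_inP; exists x.
have incX : incidences R X V = p.*2 * t.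
  by rewrite /incidences (eq_bigr (fun=> t)) // sum_nat_const cX.
have degV v : v \in V -> 1 < #|[set x in D1 :|: D2 | R x v]|.
  rewrite inE => /exists_inP[x xX xv].
  suff [y [yD yx yv]] : exists y, [/\ y \in D1 :|: D2, y != x & R y v].
    apply: (@leq_trans #|[set y; x]|); first by rewrite cards2 yx.
    apply/subset_leq_card/subsetP => z; rewrite !in_set2 => /orP[]/eqP ->.
      by rewrite inE yD.
    by rewrite !inE xv andbT; move: xX; rewrite !inE => /orP[]/andP[_ ->]; rewrite ?orbT.
  case/setUP: xX => /setDP[xD xD'].
    have : [exists x in D2, R x v] by rewrite -meet; apply/exists_inP; exists x.
    case/exists_inP => y yD yv; exists y; rewrite inE yD orbT; split => //.
    by apply: contraNneq xD' => <-.
  have : [exists x in D1, R x v] by rewrite meet; apply/exists_inP; exists x.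
  case/exists_inP => y yD yv; exists y; rewrite inE yD; split => //.
  by apply: contraNneq xD' => <-.
have incU : #|V| * 2 <= incidences R (D1 :|: D2) V.
  by rewrite incidencesC -sum_nat_const; apply: leq_sum.
have U0 : D1 :|: D2 != set0 by rewrite -card_gt0 cU ltn_addr.
have ltU := acyc (D1 :|: D2) V U0; have ltX := acyc X V X0.
rewrite cU -addnn leq_add2l in ltU; have {}ltU := ltU pd.
rewrite cX incX leq_double in ltX; have {}ltX := ltX pd.
have {incU}ltU := leq_ltn_trans incU ltU.
(* The bounds say |V| < d + p and |V| > 2p(t - 1) >= pd, whence (p - 1)(d - 1) < 0, which is
   impossible. *)
by move: (#|V|) ltU ltX p0 pd dt d0; clear; nia.
Qed.

Lemma arrangement_query_family n d k t M : 0 < d -> d <= t.-1.*2 ->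
  arrangement t k d.*2 M -> n <= M * k ->
  exists2 F : {set {set 'I_n}}, query_family d k F & #|F| <= t * M.
Proof.
move=> d0 dt [T [c [cardT injc acyc]]] nMk.
have cardA : n <= #|{: T * 'I_k}| by rewrite card_prod cardT card_ord.
pose f (x : 'I_n) : T * 'I_k := enum_val (widen_ord cardA x).
have injf : injective f by move=> x y /enum_val_inj /(congr1 val) /= eqxy; exact: val_inj.
pose R x v := in_block c (f x) v.
have injR x y v : R x v -> R y v -> (f x).2 = (f y).2 -> x = y.
  move=> /eqP xv /eqP yv eqf; apply: injf; move: (f x) (f y) eqf xv yv.
  by move=> [a j] [b l] /= <- <- /injc ->.
exists [set [set x | R x v] | v : 'I_t * T]; last first.
  by apply: leq_trans (leq_imset_card _ _) _; rewrite card_prod cardT card_ord.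
apply/andP; split; last first.
  apply/forall_inP => _ /imsetP[v _ ->]; rewrite -[leqRHS]card_ord.
  (* Points of one block have distinct second coordinates, so a block has at most k points. *)
  rewrite -(card_in_imset (f := fun x => (f x).2)) ?max_card //.
  by move=> x y; rewrite !inE => xv yv; exact: injR xv yv.
apply: (@acyclic_separating _ _ t) => //.
  move=> x; rewrite -[RHS]card_ord.
  rewrite -(card_imset _ (f := fun i => (i, c i (f x).2 (f x).1))); last first.
    by move=> i j [].
  apply: eq_card => -[i b]; rewrite inE; apply/eqP/imsetP => /= [<-|[j _ [-> ->]]] //.
  by exists i.
apply: (@cover_acyclic _ _ _ _ (in_block c) _ f id) => //.
by move=> x y v _ _; exact: injf.
Qed.

(** * The two bounds with ceilings *)

Import Order.TTheory GRing.Theory Num.Theory.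
Local Open Scope ring_scope.

Theorem theorem4 (d : nat) (hd : (2 <= d)%N) :
  (forall n k : nat,
     (d < n)%N -> (k <= n)%N -> (d./2 + 1 <= k)%N ->
     Num.ceil ((d./2%:R + 1) * n%:R / k%:R : rat) - 1 <= (q n d k)%:Z)
  /\
  (forall k : nat, (2 <= k)%N ->
     exists N : nat, forall n : nat, (N <= n)%N ->
       (q n d k)%:Z <=
         Num.ceil (((uphalf d)%:R + 1) * (n%:R - 1) / k%:R : rat)
         + ((uphalf d)%:Z + 1)).
Proof.
split=> [n k dn kn dk | k k2].
  have k0 : (0 < k)%N by rewrite (leq_trans _ dk) // addn1.
  have [[F /andP[sepF /forall_inP sizeF] <-] _] := qP n d k0.
  rewrite addn1 in dk; have := query_count_lower sepF dn hd dk sizeF.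
  rewrite lerBlDr ceil_le_int ler_pdivrMr ?ltr0n //.
  by rewrite natr1 addrC -intS -pmulrn -!natrM ler_nat mulnC [leqRHS]mulnC mulnC.
have k0 := ltnW k2.
have [M0 arM] := arrangement_large (uphalf d).+1 k d.*2.
(* From here [n] stands for the original n minus 1, and M = floor(n / k) + 1 blocks per partition
   suffice; the summand 1 in M gives the additive term ceil(d/2) + 1. *)
exists (M0 * k).+1 => -[//|n] leMn.
have nM : (n < (n %/ k).+1 * k)%N by rewrite -ltn_divLR.
have dt : (d <= (uphalf d).+1.-1.*2)%N.
  by rewrite /= uphalf_half doubleD -{1}(odd_double_half d) leq_add2r; case: odd.
have arn : arrangement (uphalf d).+1 k d.*2 (n %/ k).+1.
  by apply/arM/leqW; rewrite leq_divRL.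
have [F qF cF] := arrangement_query_family (ltnW hd) dt arn nM.
have [_ /(_ F qF) leq_q] := qP n.+1 d k0.
have {}leq_q := leq_trans leq_q cF.
apply: (@le_trans _ _ ((uphalf d).+1 * (n %/ k).+1)%N%:Z) => //.
rewrite mulnS PoszD addrC intS [1 + _]addrC lerD2r.
rewrite -(ler_int rat); apply: le_trans (ceil_ge _).
rewrite ler_pdivlMr ?ltr0n // natr1 -[n.+1%:R]natr1 addrK -pmulrn -!natrM ler_nat.
by rewrite -mulnA leq_mul2l leq_trunc_div orbT.
Qed.
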